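(* Let $k\ge 1$ be an integer and let $\mathcal{D}$ be a finite dataset of vectors segmented into $S\ge 1$ pairwise disjoint subsets $\mathcal{D}_1,\mathcal{D}_2,\dots,\mathcal{D}_S$ (so $\mathcal{D}=\bigcup_{i=1}^S\mathcal{D}_i$). For a dataset $\mathcal{X}$ let $\mathbb{G}_k(\mathcal{X})$ denote the $k$ nearest neighbor graph of $\mathcal{X}$, and let $\mathbb{F}_k(\mathcal{D})$ denote the SIG-$k$NNG of $\mathcal{D}$ with respect to the segmentation $\mathcal{D}_1,\dots,\mathcal{D}_S$. Then $\mathbb{F}_k(\mathcal{D})$ is a segmented inclusive graph (with respect to the proximity graph construction $\mathcal{X}\mapsto\mathbb{G}_k(\mathcal{X})$). Specifically, for every $r$ with $1\le r\le S$ and any $r$ distinct integers $i_1,i_2,\dots,i_r$ chosen from $[1,S]$, we have $$\mathbb{G}_k(\mathcal{U})\subseteq \mathbb{F}_k(\mathcal{D}),\qquad \text{where } \mathcal{U}=\bigcup_{j=1}^{r}\mathcal{D}_{i_j}.$$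
   Context: $\Gamma(\cdot,\cdot)$ is a fixed real-valued distance function on vectors. For a vector $q$ and a finite set of vectors $\mathcal{X}$, $kNN(q,\mathcal{X})$ is the subset of $\mathcal{X}$ consisting of the $k$ nearest neighbors of $q$ in $\mathcal{X}$: if $|\mathcal{X}|<k$ then $kNN(q,\mathcal{X})=\mathcal{X}$; otherwise it is a $k$-element subset of $\mathcal{X}$ such that $\Gamma(o,q)<\Gamma(u,q)$ for all $o\in kNN(q,\mathcal{X})$ and all $u\in\mathcal{X}\setminus kNN(q,\mathcal{X})$. It is assumed that such a set exists (i.e., there are no ties in distance preventing it) for every $q$ and $\mathcal{X}$ for which $kNN(q,\mathcal{X})$ is used; it is then unique. $k$ nearest neighbor graph: $\mathbb{G}_k(\mathcal{X})$ is the directed graph with vertex set $\mathcal{X}$ and edge set $\{(v,o)\mid v\in\mathcal{X},\ o\in kNN(v,\mathcal{X}\setminus\{v\})\}$. SIG-$k$NNG: given $\mathcal{D}$ segmented into disjoint subsets $\mathcal{D}_1,\dots,\mathcal{D}_S$, $\mathbb{F}_k(\mathcal{D})=(V_{\mathbb{F}},E_{\mathbb{F}})$ is the directed graph with $V_{\mathbb{F}}=\mathcal{D}$ and $E_{\mathbb{F}}=\bigcup_{v\in\mathcal{D}}\bigcup_{i=1}^{S}E_i^k(v)$, where $E_i^k(v)=\{(v,o)\mid o\in kNN(v,\mathcal{D}_i\setminus\{v\})\}$. For graphs, $G\subseteq H$ means that $G$ is a sub-graph of $H$: the vertex set of $G$ is contained in that of $H$ and the edge set of $G$ is contained in that of $H$.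 Segmented inclusive graph: let $\mathbb{G}(\mathcal{X})$ denote a proximity graph constructed over a dataset $\mathcal{X}$, and let $\mathcal{D}$ be segmented into disjoint subsets $\mathcal{P}=\{\mathcal{D}_1,\dots,\mathcal{D}_S\}$. A graph $\mathbb{H}$ is a segmented inclusive graph for $\mathcal{D}$ if for all $r\in\{1,\dots,S\}$ and all $\mathcal{C}\in\mathcal{P}^{(r)}$ one has $\mathbb{G}\big(\bigcup_{e\in\mathcal{C}}e\big)\subseteq\mathbb{H}$, where $\mathcal{P}^{(r)}$ is the set of all combinations of $r$ elements of $\mathcal{P}$. *)

(* Defs.v *)
From HB Require Import structures.
From mathcomp Require Import all_boot all_order all_algebra.
From mathcomp Require Import finmap.
From mathcomp Require Import boolp classical_sets reals.

Set Implicit Arguments.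
Unset Strict Implicit.
Unset Printing Implicit Defensive.

Import Order.TTheory GRing.Theory Num.Theory.

Local Open Scope fset_scope.

Record digraph (V : choiceType) := Digraph {
  vertices : {fset V};
  edges : {fset V * V};
  edgesP : forall v o, (v, o) \in edges -> v \in vertices /\ o \in vertices
}.

Definition subgraph (V : choiceType) (G H : digraph V) : Prop :=
  vertices G `<=` vertices H /\ edges G `<=` edges H.

(* Segments are allowed to be empty. *)
Record segmentation (V : choiceType) (D : {fset V}) (S : nat) := Segmentation {
  segment :> 'I_S -> {fset V};
  segment_cover : D = \bigcup_(i in 'I_S) segment i;
  segment_disjoint : forall i j, i != j -> [disjoint segment i & segment j]
}.

(* Gamma is any real-valued dissimilarity: no metric axiom is imposed. *)
Section NearestNeighbors.
Variables (R : realType) (V : choiceType) (Gamma : V -> V -> R) (k : nat).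

Definition is_kNN (q : V) (X N : {fset V}) : Prop :=
  if (#|` X| < k)%N then N = X
  else [/\ N `<=` X, #|` N| = k &
        forall o u, o \in N -> u \in X `\` N -> (Gamma o q < Gamma u q)%R].

Definition kNN_exists (q : V) (X : {fset V}) : Prop :=
  exists N, is_kNN q X N.

(* The unique N with [is_kNN q X N] when [kNN_exists q X] holds, and the junk
   value fset0 when ties in distance leave no such N. *)
Definition kNN (q : V) (X : {fset V}) : {fset V} :=
  xget fset0 [set N | is_kNN q X N]%classic.

Lemma kNN_sub q X : kNN q X `<=` X.
Proof.
rewrite /kNN; case: xgetP => [N _ /=|_]; last exact: fsub0set.
by rewrite /is_kNN; case: ifP => [_ ->|_ []].
Qed.

Definition kNNG_edges (X : {fset V}) : {fset V * V} :=
  [fset ((v, o) : V * V) | v in X, o in kNN v (X `\ v)].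

Lemma kNNG_edgesP X v o : (v, o) \in kNNG_edges X -> v \in X /\ o \in X.
Proof.
case/imfset2P => /= w wX [p pN [-> ->]]; split => //.
by move/fsubsetP: (kNN_sub w (X `\ w)) => /(_ p pN) /fsetD1P [].
Qed.

Definition kNNG (X : {fset V}) : digraph V := Digraph (@kNNG_edgesP X).

Section SegmentedInclusive.
Variables (D : {fset V}) (S : nat) (P : segmentation D S).

Definition SIG_edges_at (i : 'I_S) (v : V) : {fset V * V} :=
  [fset ((v, o) : V * V) | o in kNN v (P i `\ v)].

Definition SIG_edges : {fset V * V} :=
  \bigcup_(v <- D) \bigcup_(i in 'I_S) SIG_edges_at i v.

Lemma SIG_edgesP v o : (v, o) \in SIG_edges -> v \in D /\ o \in D.
Proof.
case/bigfcupP => w /andP [wD _] /bigfcupP [i _] /imfsetP /= [p pN [-> ->]].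
split => //; rewrite (segment_cover P); apply/bigfcupP; exists i.
  by rewrite mem_index_enum.
by move/fsubsetP: (kNN_sub w (P i `\ w)) => /(_ p pN) /fsetD1P [].
Qed.

Definition SIG_kNNG : digraph V := Digraph SIG_edgesP.

End SegmentedInclusive.
End NearestNeighbors.

Definition segments (V : choiceType) (D : {fset V}) (S : nat)
    (P : segmentation D S) : {fset {fset V}} :=
  [fset P i | i in 'I_S].

Definition segmented_inclusive (V : choiceType) (G : {fset V} -> digraph V)
    (D : {fset V}) (S : nat) (P : segmentation D S) (H : digraph V) : Prop :=
  forall r : nat, (1 <= r <= S)%N ->
  forall C : {fset {fset V}}, C `<=` segments P -> #|` C| = r ->
    subgraph (G (\bigcup_(e <- C) e)) H.

(* Main.v *)
(* Enlarging the dataset can only push points out of a k-nearest-neighbor list: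
   if o lies in D_i and is among the k nearest neighbors of v in a union U of
   segments containing D_i, it is already among those of v in D_i. *)
Require Import Defs.
From mathcomp Require Import all_boot all_order all_algebra.
From mathcomp Require Import finmap reals.
From mathcomp Require Import classical_sets.

Set Implicit Arguments.
Unset Strict Implicit.
Unset Printing Implicit Defensive.

Import Order.TTheory.

Local Open Scope fset_scope.

(* If o were not in [NX], all k points of [NX] would be closer to q than o is,
   hence would belong to [NY]; together with o that makes k + 1 points. *)
Lemma is_kNN_restrict (R : realType) (V : choiceType) (Gamma : V -> V -> R)
    (k : nat) (q o : V) (X Y NX NY : {fset V}) :
  X `<=` Y -> is_kNN Gamma k q X NX -> is_kNN Gamma k q Y NY ->
  o \in NY -> o \in X -> o \in NX.
Proof.
(* If [X] has fewer than [k] points, [NX] is all of [X] and contains [o]. Otherwise [Y] also has at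
   least [k] points, so both lists have exactly [k] elements. *)
move=> sXY; rewrite /is_kNN; case: ltnP => [_ -> //|kX].
rewrite ltnNge (leq_trans kX (fsubset_leq_card sXY)) /=.
move=> [sNX cNX nearX] [sNY cNY nearY] oNY oX; apply: contraT => oNX.
have sub : o |` NX `<=` NY.
  apply/fsubsetP => n /fset1UP [-> //|nNX]; apply: contraT => nNY.
  have lt_no : (Gamma n q < Gamma o q)%R by apply: nearX; rewrite // inE oNX.
  have lt_on : (Gamma o q < Gamma n q)%R.
    by apply: nearY; rewrite // inE nNY (fsubsetP sXY) ?(fsubsetP sNX).
  by move: (lt_trans lt_no lt_on); rewrite ltxx.
by move: (fsubset_leq_card sub); rewrite cardfsU1 oNX cNX cNY add1n ltnn.
Qed.

Lemma kNNP (R : realType) (V : choiceType) (Gamma : V -> V -> R) (k : nat)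
    (q : V) (X : {fset V}) :
  kNN_exists Gamma k q X -> is_kNN Gamma k q X (kNN Gamma k q X).
Proof. by case=> N kN; rewrite /kNN; case: xgetP => [M _ //|/(_ N)]. Qed.

(** Common form of both conclusions of the theorem: a union of segments is described by a set of
    indices, whether it comes from a set of segments or from a family of indices. *)
Lemma kNNG_bigcup_sub (R : realType) (V : choiceType) (Gamma : V -> V -> R)
    (k : nat) (D : {fset V}) (S : nat) (P : segmentation D S) (I : {set 'I_S}) :
  (forall v i, v \in D -> kNN_exists Gamma k v (P i `\ v)) ->
  (forall v, v \in \bigcup_(i in I) P i ->
     kNN_exists Gamma k v ((\bigcup_(i in I) P i) `\ v)) ->
  subgraph (kNNG Gamma k (\bigcup_(i in I) P i)) (SIG_kNNG Gamma k P).
Proof.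
move=> exP exU; set U := \bigcup_(i in I) P i.
have sUD : U `<=` D.
  apply/fsubsetP => v /bigfcupP [i _ vi]; rewrite (segment_cover P).
  by apply/bigfcupP; exists i; rewrite ?mem_index_enum.
split=> //; apply/fsubsetP => _ /imfset2P [/= v vU [o oN ->]].
have vD : v \in D := fsubsetP sUD v vU.
(* The edge from [v] to [o] is found in the part of the SIG contributed by the segment [P i] that
   contains [o]; [v] itself may lie in another segment. *)
have /fsetD1P [ov /bigfcupP [i /andP [_ iI] oi]] := fsubsetP (kNN_sub _ _ _ _) o oN.
apply/bigfcupP; exists v; rewrite ?vD //.
apply/bigfcupP; exists i; rewrite ?mem_index_enum //.
apply/imfsetP; exists o => //=.
apply: (is_kNN_restrict _ (kNNP (exP v i vD)) (kNNP (exU v vU))) => //.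
  apply/fsetSD/fsubsetP => x xi; apply/bigfcupP; exists i => //.
  by rewrite mem_index_enum.
by rewrite !inE ov.
Qed.

Theorem theorem1 (R : realType) (d : nat)
    (Gamma : 'rV[R]_d -> 'rV[R]_d -> R) (k : nat) (hk : (1 <= k)%N)
    (D : {fset 'rV[R]_d}) (S : nat) (hS : (1 <= S)%N) (P : segmentation D S)
    (kNN_segment : forall (v : 'rV[R]_d) (i : 'I_S), v \in D ->
       kNN_exists Gamma k v (P i `\ v))
    (kNN_union : forall (I : {set 'I_S}) (v : 'rV[R]_d),
       v \in \bigcup_(i in I) P i ->
       kNN_exists Gamma k v ((\bigcup_(i in I) P i) `\ v)) :
  segmented_inclusive (kNNG Gamma k) P (SIG_kNNG Gamma k P) /\
  (forall r : nat, (1 <= r <= S)%N ->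
   forall i : 'I_r -> 'I_S, injective i ->
     subgraph (kNNG Gamma k (\bigcup_(j in 'I_r) P (i j))) (SIG_kNNG Gamma k P)).
Proof.
have subU (I : {set 'I_S}) :=
  kNNG_bigcup_sub (I := I) kNN_segment (@kNN_union I).
split=> [r _ C /fsubsetP sC _|r _ i _].
  (* Several indices may name the same empty segment, so all indices with [P j] in [C] are taken;
     the union is unaffected. *)
  suff -> : \bigcup_(e <- C) e = \bigcup_(j in [set j | P j \in C]) P j by [].
  apply/fsetP => x; apply/bigfcupP/bigfcupP => [[e /andP [eC _] xe]|].
    have /imfsetP [/= j _ eE] := sC e eC.
    by exists j; rewrite -?eE // mem_index_enum inE -eE.
  by case=> j /andP [_]; rewrite inE => jC xj; exists (P j); rewrite ?jC.
(* Here the index set is the image of [i]. *)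
suff -> : \bigcup_(j in 'I_r) P (i j) = \bigcup_(l in [set i j | j : 'I_r]) P l.
  by [].
apply/fsetP => x; apply/bigfcupP/bigfcupP => [[j _ xj]|].
  by exists (i j); rewrite // mem_index_enum imset_f.
by case=> l /andP [_ /imsetP [j _ ->]] xj; exists j; rewrite // mem_index_enum.
Qed.
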